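(* Let $\{A_k\}_{k\ge 0}$ be i.i.d. complex valued random variables with $\mathbb{P}(A_0=0)<1$ and $\mathbb{E}[|A_0|^2]<\infty$, and let $P_n(z)=\sum_{k=0}^n A_k z^k$. Then $$\lim_{n\to\infty}\frac{1}{n}\frac{\|P_n'\|_2}{\|P_n\|_2}=\frac{1}{\sqrt{3}}\quad\text{almost surely.}$$ Hence the average Bernstein-Markov factors satisfy $$\lim_{n\to\infty}\frac{1}{n}\,\mathbb{E}\left[\frac{\|P_n'\|_2}{\|P_n\|_2}\right]=\frac{1}{\sqrt{3}}.$$
   Context: For a polynomial $P$, $\|P\|_2=\left(\frac{1}{2\pi}\int_0^{2\pi}|P(e^{it})|^2\,dt\right)^{1/2}$ is the $L^2$ norm on the unit circle, and $P'$ is the derivative of $P$ in $z$. Convention: the ratio $\|P'\|_2/\|P\|_2$ (the Bernstein-Markov factor) is set equal to $0$ when $P\equiv 0$. *)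

(* Defs.v *)
From HB Require Import structures.
From mathcomp Require Import all_boot all_order all_algebra.
From mathcomp Require Import finmap complex.
From mathcomp Require Import all_classical all_reals all_analysis.
Set Implicit Arguments.
Unset Strict Implicit.
Unset Printing Implicit Defensive.
Import Order.TTheory GRing.Theory Num.Theory.
Import numFieldNormedType.Exports.

Local Open Scope classical_set_scope.
Local Open Scope ring_scope.

(* R[i] with its Borel sigma-algebra. R[i]^o is R[i] with the topology of its
   norm; R[i] itself has no canonical topology or measurable structure. *)
Notation borelC R := (g_sigma_algebraType (@open R[i]^o)).

Section Iid.
Context d d' {T : measurableType d} {T' : measurableType d'} {R : realType}.
Context {I : choiceType} (P : probability T R) (X : I -> {RV P >-> T'}).

Definition mutually_independent : Prop :=
  forall (J : {fset I}) (B : I -> set T'), (forall i, measurable (B i)) ->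
    (P (\bigcap_(i in [set` J]) (X i @^-1` B i)) =
     \prod_(i <- J) P (X i @^-1` B i))%E.

Definition identically_distributed : Prop :=
  forall (i j : I) (B : set T'), measurable B ->
    distribution P (X i) B = distribution P (X j) B.

Definition iid : Prop := mutually_independent /\ identically_distributed.

End Iid.

Section BernsteinMarkov.
Context {R : realType}.
Implicit Type p : {poly R[i]}.

(* The modulus of a complex number as an element of R; the norm `|z| of the
   library lives in R[i]. *)
Definition modulus (z : R[i]) : R := ComplexField.Normc.normc z.

Definition expi (t : R) : R[i] := (cos t +i* sin t)%C.

Definition L2norm p : R :=
  Num.sqrt ((2 * pi)^-1 *
    \int[lebesgue_measure]_(t in `[0, 2 * pi]) (modulus p.[expi t] ^+ 2)).

Definition bernstein_markov p : R :=
  if p == 0 then 0 else L2norm p^`() / L2norm p.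

End BernsteinMarkov.

Definition random_poly d (T : measurableType d) (R : realType)
    (P : probability T R) (A : nat -> {RV P >-> borelC R}) (n : nat) (w : T)
    : {poly R[i]} :=
  \sum_(0 <= k < n.+1) (A k w : R[i]) *: 'X^k.

(* Main.v *)
(** By Parseval, with [X_k = |A_k|^2], the Bernstein-Markov factor of [P_n] is
    [sqrt (\sum_(k <= n) k^2 X_k) / sqrt (\sum_(k <= n) X_k)]. The strong law of
    large numbers gives [\sum_(k < n) X_k ~ n m] with [m = E X_0 > 0], and Abel
    summation then gives [\sum_(k < n) k^2 X_k ~ n^3 m / 3]. As the factor of
    [P_n] is at most [n], the convergence of the means is dominated convergence.

    The strong law is proved as by Etemadi: for [a > 1], compare the sum of the
    first [a ^ j] variables with that of the variables truncated at [a ^ j]. The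
    expected number of truncated terms plus the normalized variance is summable
    over [j], whence convergence along [a ^ j]; since the terms are nonnegative,
    letting [a] decrease to 1 gives convergence along all integers. *)

Require Import Defs.
From HB Require Import structures.
From mathcomp Require Import all_boot all_order all_algebra.
From mathcomp Require Import complex finmap ring lra.
From mathcomp Require Import all_classical all_reals all_analysis.
From mathcomp Require Import measurable_realfun.
Import Order.TTheory GRing.Theory Num.Theory.
Import numFieldNormedType.Exports.

Local Open Scope classical_set_scope.
Local Open Scope ring_scope.

(** * Sums and limits of real sequences *)

(* For x, y > 0 the summand is at most C (V (a y) - V y), where
   V y = x y / (x + y) <= x, so the sum telescopes along y = a ^ j. *)
Lemma geometric_truncated_sum_le (R : realFieldType) (a x : R) (n : nat) :
  1 < a -> 0 <= x ->
  \sum_(0 <= j < n) (if x <= a ^+ j then x ^+ 2 / a ^+ j else a ^+ j) <=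
  2 * (1 + a) / (a - 1) * x.
Proof.
move=> a1 x0; have a10 : 0 < a - 1 by rewrite subr_gt0.
have C0 : 0 <= 2 * (1 + a) / (a - 1) by apply: divr_ge0; lra.
pose V y := x * y / (x + y).
have step y : 0 < y -> (if x <= y then x ^+ 2 / y else y) <=
    2 * (1 + a) / (a - 1) * (V (a * y) - V y).
  move=> y0.
  have xy0 : 0 < x + y by lra.
  have ay0 : 0 < a * y by apply: mulr_gt0; lra.
  have xay0 : 0 < x + a * y by lra.
  have -> : V (a * y) - V y =
      x ^+ 2 * y * (a - 1) / ((x + a * y) * (x + y)).
    by rewrite /V; field; rewrite !gt_eqF.
  have -> : 2 * (1 + a) / (a - 1) *
      (x ^+ 2 * y * (a - 1) / ((x + a * y) * (x + y))) =
      2 * (1 + a) * (x ^+ 2 * y) / ((x + a * y) * (x + y)).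
    by field; rewrite !gt_eqF.
  have p0 : 0 < (x + a * y) * (x + y) by apply: mulr_gt0.
  (* With [M] the larger of [x] and [y], the two factors of the denominator are at most
     [(1 + a) * M] and [2 * M]. Their constants give [2 * (1 + a)]; the division by [a - 1] cancels
     that factor of the increment of [V]. *)
  rewrite ler_pdivlMr//; case: (leP x y) => xy.
    rewrite mulrAC ler_pdivrMr//.
    have -> : 2 * (1 + a) * (x ^+ 2 * y) * y =
       x ^+ 2 * (((1 + a) * y) * (2 * y)) by ring.
    apply: ler_wpM2l; first exact: sqr_ge0.
    by apply: ler_pM; lra.
  have x0' : 0 < x by exact: lt_trans xy.
  have -> : 2 * (1 + a) * (x ^+ 2 * y) = y * (((1 + a) * x) * (2 * x)) by ring.
  apply: ler_wpM2l; first exact: ltW.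
  have ayx : a * y <= a * x by apply: ler_wpM2l; lra.
  by apply: ler_pM; lra.
have V1 : 0 <= V 1 by rewrite /V mulr1; apply: divr_ge0; lra.
have Vx y : 0 < y -> V y <= x.
  move=> y0; rewrite /V ler_pdivrMr; last lra.
  by apply: ler_wpM2l => //; lra.
apply: (@le_trans _ _ (2 * (1 + a) / (a - 1) *
    \sum_(0 <= j < n) (V (a ^+ j.+1) - V (a ^+ j)))).
  rewrite mulr_sumr; apply: ler_sum => j _.
  by rewrite (exprS a); apply: step; apply: exprn_gt0; lra.
apply: ler_wpM2l => //.
rewrite telescope_sumr// expr0 lerBlDr.
have : V (a ^+ n) <= x by apply: Vx; apply: exprn_gt0; lra.
lra.
Qed.

(** If [a ^ j <= n < a ^ j.+1], monotonicity encloses [S n] between the values of [S] at the two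
    truncated powers, and replacing [n] by either power costs a factor of at most [a]. Ratios [a]
    arbitrarily close to 1 make this cost negligible. *)
Lemma cvg_mean_of_geometric_subseq (R : realType) (S : nat -> R) (m : R) :
  0 <= S 0%N -> {homo S : i j / (i <= j)%N >-> i <= j} ->
  (forall q : nat, let a : R := 1 + q.+1%:R^-1 in
     S (Num.truncn (a ^+ j)) / a ^+ j @[j --> \oo] --> m) ->
  n%:R^-1 * S n @[n --> \oo] --> m.
Proof.
move=> S00 Smono Hq.
have S0 n : 0 <= S n by apply: (le_trans S00); exact: Smono.
have m0 : 0 <= m.
  apply: (cvgr_to_ge (Hq 0%N)); apply: nearW => j; apply: divr_ge0.
    exact: S0.
  by apply: exprn_ge0; rewrite addr_ge0// invr_ge0.
apply/cvgrPdist_le => e e0.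
(* This [q] makes the cost of the ratio, [(a - 1) * (m + e)], at most [e / 2]; the convergence along
   the powers of [a] is then used with error [e / 4]. *)
have [q hq] : exists q : nat, 2 * (m + e) / e < q%:R.
  by exists (Num.truncn (2 * (m + e) / e)).+1; exact: truncnS_gt.
set a : R := 1 + q.+1%:R^-1.
have q0 : 0 < q.+1%:R :> R by rewrite ltr0Sn.
have a1 : 1 < a by rewrite ltrDl invr_gt0.
have me : (a - 1) * (m + e) <= e / 2.
  rewrite /a addrC addKr mulrC ler_pdivrMr//.
  rewrite -[q.+1%:R]natr1; move: hq; rewrite ltr_pdivrMr//; nra.
have e40 : 0 < e / 4 by rewrite divr_gt0.
have /cvgrPdist_le/(_ _ e40)[J _ HJ] := Hq q.
have {}HJ j : (J <= j)%N -> `|m - S (Num.truncn (a ^+ j)) / a ^+ j| <= e / 4.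
  exact: HJ.
have age0 j : 0 < a ^+ j by apply: exprn_gt0; lra.
exists (Num.truncn (a ^+ J)).+1 => // n /= nJ.
have nJ' : a ^+ J < n%:R by rewrite -truncn_lt_nat// ltW.
have n0 : 0 < n%:R :> R by apply: lt_trans nJ'.
have [j0 hj0] : exists j, n%:R < a ^+ j.
  have : a ^- j @[j --> \oo] --> (0 : R).
    under eq_fun do rewrite -exprVn.
    by apply: cvg_expr; rewrite ger0_norm ?invr_ge0 ?invf_lt1; lra.
  have nV : 0 < n%:R^-1 :> R by rewrite invr_gt0.
  move=> /cvgrPdist_lt/(_ _ nV)[j _ /(_ j (leqnn j))].
  rewrite sub0r normrN ger0_norm ?invr_ge0 ?ltW// => h.
  by exists j; rewrite -ltf_pV2 ?posrE.
have ex : exists j, n%:R < a ^+ j by exists j0.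
(* The least exponent with [n < a ^ j] is not 0, because [n > a ^ J >= 1]; its predecessor [j]
   satisfies [a ^ j <= n]. *)
case: (ex_minnP ex) => -[|j] hj hmin.
  have : a ^+ 0 <= a ^+ J by rewrite expr0 exprn_ege1// ltW.
  by move=> h; have := lt_trans (le_lt_trans h nJ') hj; rewrite ltxx.
have jn : a ^+ j <= n%:R.
  by rewrite leNgt; apply/negP => /hmin; rewrite ltnn.
have Jj : (J <= j)%N.
  rewrite -ltnS -(ltr_eXn2l a1).
  exact: lt_trans hj.
have := HJ _ Jj; have := HJ _ (leqW Jj).
rewrite !ler_distl => /andP[up _] /andP[_ lo].
have Su : S n <= S (Num.truncn (a ^+ j.+1)).
  by apply: Smono; rewrite truncn_ge_nat ltW.
have Sl : S (Num.truncn (a ^+ j)) <= S n.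
  apply: Smono; rewrite -(ler_nat R); apply: le_trans jn.
  by rewrite truncn_le ltW.
have ajS : a ^+ j.+1 <= a * n%:R by rewrite exprS ler_wpM2l//; lra.
have up' : S n <= (m + e / 4) * (a * n%:R).
  move: up; rewrite lerBlDr ler_pdivrMr// => up.
  apply: (le_trans Su); apply: (le_trans up); apply: ler_wpM2l => //; lra.
have lo' : (m - e / 4) * n%:R <= a * S n.
  move: lo; rewrite -lerBlDr ler_pdivlMr// => lo.
  (* A negative lower bound holds trivially, since [S n] is nonnegative. *)
  have [me4|me4] := leP 0 (m - e / 4); last first.
    apply: (@le_trans _ _ 0); last by apply: mulr_ge0; [lra|].
    by apply: mulr_le0_ge0; exact: ltW.
  apply: (@le_trans _ _ ((m - e / 4) * a ^+ j.+1)).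
    by apply: ler_wpM2l => //; exact: ltW.
  rewrite exprS mulrCA; apply: ler_wpM2l; first lra.
  exact: le_trans Sl.
rewrite mulrC; apply/andP; split.
  rewrite lerBlDr ler_pdivrMr//; apply: (le_trans up').
  rewrite mulrA; apply: ler_wpM2r; first exact: ltW.
  nra.
rewrite -lerBlDr ler_pdivlMr//.
have : a * ((m - e) * n%:R) <= a * S n.
  apply: le_trans lo'; rewrite mulrA; apply: ler_wpM2r; first exact: ltW.
  nra.
by rewrite ler_pM2l//; lra.
Qed.

(** Abel summation writes the weighted sum as [n ^ 2 * s n] minus the sum of [(2 k + 1) * s k.+1].
    Since [s k] is asymptotic to [m * k], these two parts, divided by [n ^ 3], tend to [m] and
    [2 m / 3]. *)
Lemma cvg_sum_sqr_weighted (R : realType) (x : nat -> R) (m : R) :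
  n.+1%:R^-1 * (\sum_(0 <= k < n.+1) x k) @[n --> \oo] --> m ->
  n.+1%:R^-1 ^+ 3 * (\sum_(0 <= k < n.+1) k%:R ^+ 2 * x k) @[n --> \oo]
    --> m / 3.
Proof.
pose s n := \sum_(0 <= k < n) x k.
pose u n := n.+1%:R^-1 * s n.+1.
move=> um; have {}um : u @ \oo --> m by exact: um.
have abel n : \sum_(0 <= k < n) k%:R ^+ 2 * x k =
    n%:R ^+ 2 * s n - \sum_(0 <= k < n) (2 * k%:R + 1) * s k.+1.
  elim: n => [|n IH]; first by rewrite /s !big_geq// mulr0 subr0.
  rewrite !big_nat_recr//= IH /s !big_nat_recr//= -[n.+1%:R]natr1; ring.
have sumsq n : \sum_(0 <= k < n) k.+1%:R ^+ 2 =
    n%:R * (n%:R + 1) * (2 * n%:R + 1) / 6 :> R.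
  elim: n => [|n IH]; first by rewrite big_geq// !mul0r.
  by rewrite big_nat_recr//= IH -[n.+1%:R]natr1; field.
pose h n : R := n.+1%:R^-1.
have h0 : h @ \oo --> 0 by exact: cvg_harmonic.
pose d n := `|(2 - h n) * u n - 2 * m|.
have d0 : d @ \oo --> 0.
  have -> : 0 = `|(2 - 0) * m - 2 * m| by rewrite subr0 subrr normr0.
  apply: cvg_norm; apply: cvgB; last exact: cvg_cst.
  by apply: cvgM => //; apply: cvgB => //; exact: cvg_cst.
(* [E] is the error made in replacing [s k.+1] by its asymptotic value. Its [k]-th term has modulus
   [(k + 1) ^ 2 * d k], and [(k + 1) ^ 2 <= (n + 1) ^ 2], so [E n] is dominated by the Cesaro mean
   of [d]. *)
pose E n := h n ^+ 3 * \sum_(0 <= k < n.+1)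
  ((2 * k%:R + 1) * s k.+1 - 2 * m * k.+1%:R ^+ 2).
have E0 : E @ \oo --> 0.
  have := cesaro d0; rewrite /arithmetic_mean /= => dm.
  apply/norm_cvg0P.
  apply: (@squeeze_cvgr _ _ _ _ (cst 0) _ _ _ _ _ dm); last exact: cvg_cst.
  apply: nearW => n /=; rewrite normr_ge0/= /E normrM /series /= -/(h n).
  have hn0 : 0 <= h n by rewrite invr_ge0.
  rewrite (ger0_norm (exprn_ge0 _ hn0)) exprSr mulrAC [leRHS]mulrC.
  apply: ler_wpM2r => //.
  rewrite mulrC -ler_pdivlMr ?exprn_gt0 ?invr_gt0//.
  apply: (le_trans (ler_norm_sum _ _ _)).
  rewrite mulr_suml; apply: ler_sum_nat => k /andP[_ kn].
  rewrite ler_pdivlMr ?exprn_gt0 ?invr_gt0//.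
  have -> : (2 * k%:R + 1) * s k.+1 - 2 * m * k.+1%:R ^+ 2 =
      k.+1%:R ^+ 2 * ((2 - h k) * u k - 2 * m).
    rewrite /u /h -[k.+1%:R]natr1; field.
    by rewrite natr1 pnatr_eq0.
  rewrite normrM -/(d k) mulrAC; apply: ler_piMl; first exact: normr_ge0.
  rewrite ger0_norm ?exprn_ge0// -exprMn.
  apply: exprn_ile1; first by rewrite mulr_ge0.
  by rewrite ler_pdivrMr// mul1r ler_nat.
(* By [sumsq], the sum of the first [n + 1] squares divided by [(n + 1) ^ 3] is
   [(1 + h n) * (2 + h n) / 6]. *)
have -> : m / 3 = m - m / 3 * ((1 + 0) * (2 + 0)) - 0 by field.
suff -> : (fun n => n.+1%:R^-1 ^+ 3 * (\sum_(0 <= k < n.+1) k%:R ^+ 2 * x k)) =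
    (fun n => u n - m / 3 * ((1 + h n) * (2 + h n)) - E n).
  apply: cvgB => //; apply: cvgB => //; apply: cvgM; first exact: cvg_cst.
  by apply: cvgM; apply: cvgD => //; exact: cvg_cst.
apply/funext => n.
rewrite abel /E sumrB -mulr_sumr sumsq /u /h; field.
by rewrite nat1r pnatr_eq0.
Qed.

Lemma cvg_sqrt_ratio (R : realType) (x : nat -> R) (m : R) : 0 < m ->
  n.+1%:R^-1 * (\sum_(0 <= k < n.+1) x k) @[n --> \oo] --> m ->
  n%:R^-1 * (Num.sqrt (\sum_(0 <= k < n.+1) k%:R ^+ 2 * x k) /
             Num.sqrt (\sum_(0 <= k < n.+1) x k)) @[n --> \oo]
    --> (Num.sqrt 3)^-1.
Proof.
move=> m0 xm.
(* [c] trades the normalization by [n] for that by [n + 1]. At [n = 0] the inverse of 0 is 0, so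
   both sides of [E] below vanish. *)
pose c n : R := n.+1%:R / n%:R.
have c1 : c @ \oo --> (1 : R).
  rewrite -cvg_shiftS /=.
  have -> : (fun n => c n.+1) = (fun n => 1 + n.+1%:R^-1).
    apply/funext => n; rewrite /c -[n.+2%:R]natr1; field.
    by rewrite nat1r pnatr_eq0.
  suff : 1 + n.+1%:R^-1 @[n --> \oo] --> (1 + 0 : R) by rewrite addr0.
  by apply: cvgD; [exact: cvg_cst|exact: cvg_harmonic].
have sq (y : nat -> R) (l : R) : y @ \oo --> l ->
    Num.sqrt (y n) @[n --> \oo] --> Num.sqrt l.
  by move=> yl; apply: continuous_cvg => //; exact: sqrt_continuous.
have -> : (Num.sqrt 3)^-1 = 1 * (Num.sqrt (m / 3) / Num.sqrt m).
  rewrite mul1r sqrtrM ?ltW// sqrtrV// mulrAC divff ?mul1r//.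
  by rewrite gt_eqF// sqrtr_gt0.
have sm0 : Num.sqrt m != 0 by rewrite gt_eqF// sqrtr_gt0.
have E n : n%:R^-1 * (Num.sqrt (\sum_(0 <= k < n.+1) k%:R ^+ 2 * x k) /
             Num.sqrt (\sum_(0 <= k < n.+1) x k)) =
   c n * (Num.sqrt (n.+1%:R^-1 ^+ 3 * \sum_(0 <= k < n.+1) k%:R ^+ 2 * x k) /
             Num.sqrt (n.+1%:R^-1 * \sum_(0 <= k < n.+1) x k)).
  have h0 : 0 < n.+1%:R^-1 :> R by rewrite invr_gt0.
  have hr0 : Num.sqrt n.+1%:R^-1 != 0 :> R by rewrite gt_eqF// sqrtr_gt0.
  rewrite /c exprS exprSr expr1.
  set W := \sum_(_ <= _ < _) _; set T := \sum_(_ <= _ < _) _.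
  rewrite mulrA -expr2 -mulrA.
  rewrite sqrtrM ?exprn_ge0 ?ltW// sqrtr_sqr gtr0_norm// !sqrtrM ?ltW//.
  rewrite -mulrA -mulf_div divff// mul1r [RHS]mulrA; congr (_ * _).
  by rewrite mulrAC divff ?mul1r// pnatr_eq0.
under eq_fun do rewrite E.
apply: cvgM => //; apply: cvgM; first exact/sq/cvg_sum_sqr_weighted.
by apply: cvgV => //; exact: sq.
Qed.

(** * Parseval's identity for polynomials on the unit circle *)

Lemma is_derive_sum_fun (R : realType) (n : nat) (h : 'I_n -> R -> R) (x : R)
    (dh : 'I_n -> R) : (forall i, is_derive x 1 (h i) (dh i)) ->
  is_derive x 1 (fun t => \sum_(i < n) h i t) (\sum_(i < n) dh i).
Proof.
move=> hdh; have := is_derive_sum hdh.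
by congr (is_derive _ _ _ _); apply/funext => t; rewrite fct_sumE.
Qed.

Lemma expiX (R : realType) (t : R) (k : nat) :
  expi t ^+ k = expi (k%:R * t).
Proof.
elim: k => [|k IH]; first by rewrite expr0 mul0r /expi cos0 sin0.
rewrite exprS IH /expi -[k.+1%:R]natr1 mulrDl mul1r cosD sinD.
by apply/eqP; rewrite eq_complex /=; apply/andP; split; apply/eqP; ring.
Qed.

Lemma modulus_sqr (R : realType) (z : R[i]) :
  modulus z ^+ 2 = complex.Re z ^+ 2 + complex.Im z ^+ 2.
Proof. by case: z => a b; rewrite sqr_sqrtr// addr_ge0 ?sqr_ge0. Qed.

(** The summand is the real part of [p_k * conj p_l * e^(i (k - l) t)], from the expansion of
    [p * conj p]. *)
Lemma modulus_sqr_horner_expi (R : realType) (p : {poly R[i]}) (n : nat)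
    (t : R) :
  (size p <= n)%N -> modulus p.[expi t] ^+ 2 = 
    \sum_(k < n) \sum_(l < n)
    ((complex.Re p`_k * complex.Re p`_l + complex.Im p`_k * complex.Im p`_l) *
       cos ((k%:R - l%:R) * t) +
     (complex.Re p`_k * complex.Im p`_l - complex.Im p`_k * complex.Re p`_l) *
       sin ((k%:R - l%:R) * t)).
Proof.
move=> pn; rewrite modulus_sqr (horner_coef_wide _ pn).
have ReS (F : 'I_n -> R[i]) :
    complex.Re (\sum_(i < n) F i) = \sum_(i < n) complex.Re (F i).
  by apply: (big_morph _ _ _) => [[? ?] [? ?]|].
have ImS (F : 'I_n -> R[i]) :
    complex.Im (\sum_(i < n) F i) = \sum_(i < n) complex.Im (F i).
  by apply: (big_morph _ _ _) => [[? ?] [? ?]|].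
rewrite ReS ImS !expr2 !big_distrlr -big_split/=; apply: eq_bigr => k _.
rewrite -big_split/=; apply: eq_bigr => l _.
rewrite !expiX mulrBl cosB sinB.
case: p`_k => a b; case: p`_l => c d /=; ring.
Qed.

Lemma cos_sin_nat2pi (R : realType) (k : nat) :
  cos (k%:R * (2 * pi)) = 1 :> R /\ sin (k%:R * (2 * pi)) = 0 :> R.
Proof.
have e : expi (2 * pi) = 1 :> R[i] by rewrite /expi mulr_natl cos2pi sin2pi.
by have := expiX _ (2 * pi : R) k; rewrite e expr1n => -[<- <-].
Qed.

(** The integral is read off an explicit primitive: its off-diagonal terms have period [2 * pi] and
    cancel, leaving only the linear terms [c k k * t]. *)
Lemma integral_trigonometric_sum (R : realType) (n : nat)
    (c s : 'I_n -> 'I_n -> R) :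
  (forall k, s k k = 0) ->
  \int[lebesgue_measure]_(t in `[0, 2 * pi]) (\sum_(k < n) \sum_(l < n)
    (c k l * cos ((k%:R - l%:R) * t) + s k l * sin ((k%:R - l%:R) * t))) =
  2 * pi * \sum_(k < n) c k k.
Proof.
move=> skk.
pose f (t : R) := \sum_(k < n) \sum_(l < n)
    (c k l * cos ((k%:R - l%:R) * t) + s k l * sin ((k%:R - l%:R) * t)).
pose F (t : R) := \sum_(k < n) \sum_(l < n) (if k == l then c k k * t else
  - s k l / (k%:R - l%:R) * cos ((k%:R - l%:R) * t) +
  c k l / (k%:R - l%:R) * sin ((k%:R - l%:R) * t)).
have dF (t : R) : is_derive t (1 : R) F (f t).
  apply: is_derive_sum_fun => k; apply: is_derive_sum_fun => l.
  have [<-{l}|kl] := eqVneq k l.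
    by apply: is_derive_eq; rewrite subrr mul0r cos0 skk mul0r addr0.
  have w0 : k%:R - l%:R != 0 :> R.
    by rewrite subr_eq0 eqr_nat.
  by apply: is_derive_eq; rewrite /GRing.scale/=; field.
have cf : continuous f.
  move=> t; apply: differentiable_continuous; apply/derivable1_diffP.
  pose df (k l : 'I_n) : R := (k%:R - l%:R) *
    (s k l * cos ((k%:R - l%:R) * t) - c k l * sin ((k%:R - l%:R) * t)).
  suff dfP : is_derive t (1 : R) f (\sum_(k < n) \sum_(l < n) df k l).
    exact: ex_derive.
  apply: is_derive_sum_fun => k; apply: is_derive_sum_fun => l.
  by apply: is_derive_eq; rewrite /df /GRing.scale/=; ring.
have cF : continuous F.
  by move=> t; apply: differentiable_continuous; apply/derivable1_diffP.
have pi0 : (0 : R) < 2 * pi by rewrite mulr_gt0// pi_gt0.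
rewrite /Rintegral (@continuous_FTC2 _ f F)//; last first.
- by move=> t _; rewrite derive1E; exact: derive_val.
- split => //.
  + by apply: cvg_at_right_filter; exact: cF.
  + by apply: cvg_at_left_filter; exact: cF.
- by apply: continuous_subspaceT.
rewrite -EFinB/= /F.
rewrite -sumrB mulr_sumr; apply: eq_bigr => k _.
rewrite -sumrB (bigD1 k)//= eqxx mulr0 subr0 big1 ?addr0 1?mulrC//.
move=> l lk; rewrite eq_sym (negbTE lk) mulr0 sin0 cos0.
(* The frequency [k - l] may be negative; splitting the angle leaves natural multiples of
   [2 * pi]. *)
rewrite [(_ - _) * (2 * pi)]mulrBl cosB sinB.
have [ck sk] := cos_sin_nat2pi R k; have [cl sl] := cos_sin_nat2pi R l.
by rewrite ck sk cl sl; ring.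
Qed.

(** Any bound [n] on the size is allowed, because the leading coefficients of a random polynomial
    may vanish. *)
Lemma L2norm_coef (R : realType) (p : {poly R[i]}) (n : nat) :
  (size p <= n)%N ->
  L2norm p = Num.sqrt (\sum_(k < n) modulus p`_k ^+ 2).
Proof.
move=> pn; rewrite /L2norm.
under eq_Rintegral do rewrite (modulus_sqr_horner_expi _ _ _ _ pn).
rewrite integral_trigonometric_sum; last by move=> k; rewrite mulrC subrr.
rewrite mulKf ?gt_eqF ?mulr_gt0 ?pi_gt0//.
by under [in RHS]eq_bigr do rewrite modulus_sqr !expr2.
Qed.

Lemma bernstein_markov_poly (R : realType) (a : nat -> R[i]) (n : nat) :
  bernstein_markov (\poly_(k < n.+1) a k) =
  Num.sqrt (\sum_(0 <= k < n.+1) k%:R ^+ 2 * modulus (a k) ^+ 2) /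
  Num.sqrt (\sum_(0 <= k < n.+1) modulus (a k) ^+ 2).
Proof.
set p := \poly_(k < n.+1) a k.
have sp : (size p <= n.+1)%N by exact: size_poly.
have sp' : (size p^`() <= n)%N.
  have [->|p0] := eqVneq p 0; first by rewrite deriv0 size_poly0.
  by rewrite -ltnS; apply: leq_trans sp; exact: lt_size_deriv.
have L2p : L2norm p = Num.sqrt (\sum_(0 <= k < n.+1) modulus (a k) ^+ 2).
  rewrite (L2norm_coef _ _ _ sp) big_mkord; congr Num.sqrt.
  by apply: eq_bigr => k _; rewrite coef_poly ltn_ord.
(* For p = 0 the quotient is 0 / 0 = 0. *)
have -> : bernstein_markov p = L2norm p^`() / L2norm p.
  rewrite /bernstein_markov; case: eqP => // p0.
  rewrite (L2norm_coef _ p 0) ?p0 ?size_poly0// big_ord0 sqrtr0.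
  by rewrite invr0 mulr0.
rewrite L2p (L2norm_coef _ _ _ sp'); congr (Num.sqrt _ / _).
(* The weight kills the term of index 0; the term of index [k + 1] matches the coefficient of index
   [k] of the derivative. *)
rewrite big_mkord big_ord_recl expr0n/= mul0r add0r; apply: eq_bigr => k _.
rewrite coef_deriv coef_poly /bump/= add1n ltnS ltn_ord /modulus normcMn.
by rewrite -[_ *+ _ in LHS]mulr_natl exprMn.
Qed.

(** * Second moments of centered sums of independent variables *)

Lemma bounded_integrable d (T : measurableType d) (R : realType)
    (P : probability T R) (h : T -> R) (M : R) :
  measurable_fun [set: T] h -> (forall w, `|h w| <= M) ->
  P.-integrable [set: T] (EFin \o h).
Proof.
move=> mh hM; apply: measurable_bounded_integrable => //.
  exact: le_lt_trans (probability_le1 P measurableT) (ltry 1).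
exists M; split => [|x Mx w _]; first exact: num_real.
exact: le_trans (hM w) (ltW Mx).
Qed.

Section Iid.
Context {d d'} {T : measurableType d} {T' : measurableType d'} {R : realType}.
Context (P : probability T R) (X : nat -> {RV P >-> T'}).
Hypothesis iidX : iid X.

Lemma independent_pair (i j : nat) (B C : set T') : i != j ->
  measurable B -> measurable C ->
  (P (X i @^-1` B `&` X j @^-1` C) = P (X i @^-1` B) * P (X j @^-1` C))%E.
Proof.
move=> ij mB mC; have [indX _] := iidX.
have := indX [fset i; j]%fset (fun k => if k == i then B else C).
rewrite big_fsetU1/= ?inE// big_seq_fset1 eqxx eq_sym (negbTE ij).
move=> <-; last by move=> k; case: ifP.
congr (P _); apply/seteqP; split => [w [Bw Cw] k|w Hw] /=.
  rewrite !inE => /orP[/eqP->|/eqP->]; first by rewrite eqxx.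
  by rewrite eq_sym (negbTE ij).
split.
  by have := Hw i; rewrite /= !inE eqxx/=; apply.
by have := Hw j; rewrite /= !inE eqxx orbT eq_sym (negbTE ij); apply.
Qed.

(** Independence says that the joint law of [X i] and [X j] agrees with the product of their laws on
    rectangles, hence everywhere; Tonelli's theorem then factors the integral. *)
Lemma ge0_integral_independent (i j : nat) (f g : T' -> \bar R) : i != j ->
  measurable_fun [set: T'] f -> measurable_fun [set: T'] g ->
  (forall x, 0 <= f x)%E -> (forall x, 0 <= g x)%E ->
  (\int[P]_w (f (X i w) * g (X j w)) =
   \int[P]_w f (X i w) * \int[P]_w g (X j w))%E.
Proof.
move=> ij mf mg f0 g0.
pose Z w := (X i w, X j w).
have mZ : measurable_fun setT Z by exact: measurable_fun_pair.
pose Zm : {mfun T >-> (T' * T')%type} :=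
  MeasurableFun.Pack (MeasurableFun.Class (isMeasurableFun.Build _ _ _ _ _ mZ)).
pose m1 := distribution P (X i); pose m2 := distribution P (X j).
pose h (z : T' * T') := (f z.1 * g z.2)%E.
have mh : measurable_fun setT h.
  by apply: emeasurable_funM; apply: measurableT_comp.
have h0 z : (0 <= h z)%E by exact: mule_ge0.
transitivity (\int[distribution P Zm]_z h z)%E.
  by rewrite ge0_integral_distribution.
transitivity (\int[(m1 \x m2)%E]_z h z)%E.
  apply: eq_measure_integral => A mA _.
  apply/esym; apply: product_measure_unique => // B C mB mC.
  exact: independent_pair.
rewrite fubini_tonelli1// /fubini_F/= /h/=.
under eq_integral => x _ do rewrite ge0_integralZl//.
rewrite ge0_integralZr//; last by apply: integral_ge0.
by rewrite !ge0_integral_distribution.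
Qed.

Lemma ge0_integral_iid (i : nat) (f : T' -> \bar R) :
  measurable_fun [set: T'] f -> (forall x, 0 <= f x)%E ->
  (\int[P]_w f (X i w) = \int[P]_w f (X 0%N w))%E.
Proof.
move=> mf f0; have [_ idX] := iidX.
have := @ge0_integral_distribution _ _ _ _ _ P (X i) f mf f0.
have := @ge0_integral_distribution _ _ _ _ _ P (X 0%N) f mf f0.
rewrite /= => <- <-.
by apply: eq_measure_integral => A mA _; exact: idX.
Qed.

Section CenteredSum.
Context (f : T' -> R) (M : R).
Hypotheses (mf : measurable_fun [set: T'] f) (f0 : forall x, 0 <= f x).
Hypothesis fM : forall x, f x <= M.

Let mu := \int[P]_w f (X 0%N w).
Let Y k w := f (X k w).

Let mY k : measurable_fun [set: T] (Y k).
Proof. exact: measurableT_comp. Qed.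

Let iY k : P.-integrable [set: T] (EFin \o Y k).
Proof.
by apply: (bounded_integrable _ _ _ _ _ M) => // w; rewrite ger0_norm ?f0 ?fM.
Qed.

Let EY k : \int[P]_w Y k w = mu.
Proof.
rewrite /Rintegral; congr fine.
apply: (ge0_integral_iid k (EFin \o f)); last by move=> x; rewrite lee_fin.
exact/measurable_EFinP.
Qed.

Let iYY k l : P.-integrable [set: T] (EFin \o (fun w => Y k w * Y l w)).
Proof.
apply: (bounded_integrable _ _ _ _ _ (M * M)); first exact: measurable_funM.
by move=> w; rewrite ger0_norm ?mulr_ge0 ?f0// ler_pM ?f0 ?fM.
Qed.

Let EYY k l : k != l -> \int[P]_w (Y k w * Y l w) = mu ^+ 2.
Proof.
move=> kl; rewrite expr2 -{1}(EY k) -(EY l) /Rintegral.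
have fY j := integrable_fin_num measurableT (iY j).
rewrite -fineM; [|exact: fY k|exact: fY l].
congr fine.
under eq_integral do rewrite EFinM.
by apply: (ge0_integral_independent k l (EFin \o f) (EFin \o f));
  rewrite ?kl//; first [exact/measurable_EFinP|move=> x; rewrite lee_fin].
Qed.

Let g k w := Y k w - mu.

Let icst (c : R) : P.-integrable [set: T] (EFin \o (fun=> c)).
Proof. by apply: (bounded_integrable _ _ _ _ _ `|c|). Qed.

Let ig k l : P.-integrable [set: T] (EFin \o (fun w => g k w * g l w)).
Proof.
have hg j w : `|g j w| <= M + `|mu|.
  by rewrite (le_trans (ler_normB _ _))// lerD2r ger0_norm ?f0 ?fM.
have mg j : measurable_fun [set: T] (g j) by exact: measurable_funB.
apply: (bounded_integrable _ _ _ _ _ ((M + `|mu|) * (M + `|mu|))).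
  exact: measurable_funM.
by move=> w; rewrite normrM ler_pM.
Qed.

(** This covers both the covariance ([k != l], where [EYY] makes it 0) and the variance
    ([k = l]). *)
Let Egg k l : \int[P]_w (g k w * g l w) = \int[P]_w (Y k w * Y l w) - mu ^+ 2.
Proof.
have -> : (fun w => g k w * g l w) =
    (fun w => Y k w * Y l w + ((- mu) * (Y k w + Y l w) + mu ^+ 2)).
  by apply/funext => w; rewrite /g; ring.
have iYp : P.-integrable [set: T] (EFin \o (fun w => Y k w + Y l w)).
  exact: (integrableD measurableT (iY k) (iY l)).
have iZ : P.-integrable [set: T] (EFin \o (fun w => (- mu) * (Y k w + Y l w))).
  exact: (integrableZl measurableT (- mu) iYp).
have iW : P.-integrable [set: T]
    (EFin \o (fun w => (- mu) * (Y k w + Y l w) + mu ^+ 2)).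
  exact: (integrableD measurableT iZ (icst _)).
rewrite RintegralD// RintegralD// RintegralZl// RintegralD// !EY.
rewrite Rintegral_cst//.
rewrite [fine (P _)](_ : _ = 1); last exact: (congr1 fine (probability_setT P)).
by ring.
Qed.

Let S n w := \sum_(0 <= k < n) g k w.

Let SS n w : S n.+1 w = S n w + g n w.
Proof. by rewrite /S big_nat_recr. Qed.

Let S0 w : S 0%N w = 0.
Proof. by rewrite /S big_geq. Qed.

(** Only deviations of index less than [m] occur in [S n], and each is uncorrelated with [g m].
    Integrability is carried through the induction to justify linearity. *)
Let Sg n m : (n <= m)%N ->
  P.-integrable [set: T] (EFin \o (fun w => S n w * g m w)) /\
  \int[P]_w (S n w * g m w) = 0.
Proof.
elim: n => [_|n IH nm].
  rewrite (_ : (fun w => _) = (fun=> 0)); last first.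
    by apply/funext => w; rewrite S0 mul0r.
  by split; [exact: icst|rewrite Rintegral_cst// mul0r].
have [iS ES] := IH (ltnW nm).
have -> : (fun w => S n.+1 w * g m w) =
    (fun w => S n w * g m w + g n w * g m w).
  by apply/funext => w; rewrite SS mulrDl.
split; first exact: (integrableD measurableT iS (ig n m)).
by rewrite RintegralD// ES Egg EYY ?ltn_eqF// subrr addr0.
Qed.

Let EYsq k : \int[P]_w (Y k w * Y k w) = \int[P]_w (f (X 0%N w)) ^+ 2.
Proof.
rewrite /Rintegral; congr fine.
apply: (ge0_integral_iid k (fun x => (f x * f x)%:E)).
  by apply/measurable_EFinP; exact: measurable_funM.
by move=> x; rewrite lee_fin mulr_ge0.
Qed.

(** In the square of [S n + g n] the cross term has mean 0 by [Sg], and the last square has mean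
    equal to the second moment minus [mu ^ 2]. *)
Let Ssq n : P.-integrable [set: T] (EFin \o (fun w => S n w * S n w)) /\
  \int[P]_w (S n w * S n w) <= n%:R * \int[P]_w (f (X 0%N w)) ^+ 2.
Proof.
elim: n => [|n [iS ES]].
  rewrite (_ : (fun w => _) = (fun=> 0)); last first.
    by apply/funext => w; rewrite S0 mul0r.
  by split; [exact: icst|rewrite Rintegral_cst// !mul0r].
have [iSg ESg] := Sg n n (leqnn n).
have iSg2 := integrableZl measurableT 2 iSg.
have iR := integrableD measurableT iSg2 (ig n n).
have -> : (fun w => S n.+1 w * S n.+1 w) =
    (fun w => S n w * S n w + (2 * (S n w * g n w) + g n w * g n w)).
  by apply/funext => w; rewrite SS; ring.
split; first exact: (integrableD measurableT iS iR).
rewrite RintegralD// RintegralD// RintegralZl// ESg mulr0 add0r.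
rewrite -[n.+1%:R]natr1 mulrDl mul1r lerD// Egg EYsq.
by rewrite lerBlDr lerDl sqr_ge0.
Qed.

(** The bound passes to the extended reals, where the means will be summed as a series. Boundedness
    by [M] is what makes all the products integrable. *)
Lemma centered_sum_sqr_le (n : nat) :
  (\int[P]_w (((\sum_(0 <= k < n) f (X k w)) - n%:R * mu) ^+ 2)%:E <=
  n%:R%:E * \int[P]_w (f (X 0%N w) ^+ 2)%:E)%E.
Proof.
have [iS ES] := Ssq n.
have -> : (fun w => (((\sum_(0 <= k < n) f (X k w)) - n%:R * mu) ^+ 2)%:E) =
    EFin \o (fun w => S n w * S n w).
  apply/funext => w /=; rewrite expr2; congr (_ * _)%:E.
    by rewrite /S sumrB sumr_const_nat subn0 mulr_natl.
  by rewrite /S sumrB sumr_const_nat subn0 mulr_natl.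
have iY0 : P.-integrable [set: T] (EFin \o (fun w => f (X 0%N w) ^+ 2)).
  exact: (iYY 0 0).
rewrite -[leLHS]fineK; last exact: integrable_fin_num iS.
rewrite -[(\int[P]_w (f (X 0%N w) ^+ 2)%:E)%E]fineK; last first.
  exact: integrable_fin_num iY0.
by rewrite -EFinM lee_fin.
Qed.

End CenteredSum.
End Iid.

(** * The strong law of large numbers *)

Lemma nneseries_lty_cvg0 (R : realType) (u : nat -> R) :
  (forall j, 0 <= u j) -> (\sum_(j <oo) (u j)%:E < +oo)%E -> u @ \oo --> 0.
Proof.
move=> u0 uoo; apply: cvg_series_cvg_0.
set L := (\sum_(j <oo) (u j)%:E)%E in uoo.
have u0' n : (0 <= n)%N -> true -> (0 <= (u n)%:E)%E by rewrite lee_fin.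
have Lfin : L \is a fin_num by rewrite ge0_fin_numE// nneseries_ge0.
apply: nondecreasing_is_cvgn.
  by apply/nondecreasing_seqP => n; rewrite /series/= big_nat_recr//= lerDl.
exists (fine L) => _ [n _ <-].
by rewrite -lee_fin fineK// /series/= -sumEFin; exact: nneseries_lim_ge.
Qed.

Section StrongLaw.
Context {d d'} {T : measurableType d} {T' : measurableType d'} {R : realType}.
Context (P : probability T R) (X : nat -> {RV P >-> T'}).
Hypothesis iidX : iid X.
(** The law concerns the variables [h (X k)]: truncating them only changes the function applied to
    [X k], so the hypothesis [iid X] serves for every truncation. *)
Context (h : T' -> R).
Hypotheses (mh : measurable_fun [set: T'] h) (h0 : forall x, 0 <= h x).
Hypothesis hoo : (\int[P]_w (h (X 0%N w))%:E < +oo)%E.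

Let m := \int[P]_w h (X 0%N w).

Section Geometric.
Context (a : R).
Hypothesis a1 : 1 < a.

Let y j := a ^+ j.
Let N j := Num.truncn (y j).
(** The truncation level depends on [j] and not on the index of the variable, so for fixed [j] the
    truncated variables are identically distributed. *)
Let f j x := if h x <= y j then h x else 0.
Let mu j := \int[P]_w f j (X 0%N w).
Let D j w := ((\sum_(0 <= k < N j) f j (X k w) - (N j)%:R * mu j) / y j) ^+ 2.
Let B j w := \sum_(0 <= k < N j) (if h (X k w) <= y j then 0 else 1) : R.
(* D is the normalized squared deviation of the truncated sum, B the number of
   truncated terms; the mean of D + B is at most that of phi (X 0). *)
Let phi j x := if h x <= y j then h x ^+ 2 / y j else y j.

Let y0 j : 0 < y j.
Proof. by apply: exprn_gt0; apply: lt_trans a1. Qed.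

Let Ny j : (N j)%:R <= y j.
Proof. by rewrite truncn_le ltW. Qed.

Let mle j (u v : T' -> R) : measurable_fun [set: T'] u ->
  measurable_fun [set: T'] v ->
  measurable_fun [set: T'] (fun x => if h x <= y j then u x else v x).
Proof.
by move=> mu' mv; apply: measurable_fun_ifT => //; exact: measurable_fun_ler.
Qed.

Let mf j : measurable_fun [set: T'] (f j).
Proof. exact: mle. Qed.

Let mphi j : measurable_fun [set: T'] (phi j).
Proof.
by apply: mle => //; apply: measurable_funM => //; exact: measurable_funX.
Qed.

Let f0 j x : 0 <= f j x.
Proof. by rewrite /f; case: ifP. Qed.

Let fy j x : f j x <= y j.
Proof. by rewrite /f; case: ifP => // _; exact: ltW. Qed.

Let mXk k (u : T' -> R) : measurable_fun [set: T'] u ->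
  measurable_fun [set: T] (fun w => u (X k w)).
Proof. by move=> mu'; exact: measurableT_comp. Qed.

Let mD j : measurable_fun [set: T] (D j).
Proof.
apply: measurable_funX; apply: measurable_funM => //.
apply: measurable_funB => //.
by apply: measurable_sum => k; exact: mXk.
Qed.

Let mB j : measurable_fun [set: T] (B j).
Proof.
apply: measurable_sum => k.
by apply: (mXk k (fun x => if h x <= y j then 0 else 1)); exact: mle.
Qed.

Let mfsq j : measurable_fun [set: T] (fun w => (f j (X 0%N w) ^+ 2)%:E).
Proof. by apply/measurable_EFinP; apply: measurable_funX; exact: mXk. Qed.

(** The variance bound gives [N j / y j ^ 2] times the second moment, and [N j <= y j]. *)
Let ID j : (\int[P]_w (D j w)%:E <= \int[P]_w (f j (X 0%N w) ^+ 2 / y j)%:E)%E.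
Proof.
have yV : 0 <= (y j)^-1 by rewrite invr_ge0 ltW.
have -> : (fun w => (D j w)%:E) = (fun w => ((y j)^-1 ^+ 2)%:E *
    (((\sum_(0 <= k < N j) f j (X k w)) - (N j)%:R * mu j) ^+ 2)%:E)%E.
  by apply/funext => w; rewrite -EFinM /D mulrC exprMn.
have -> : (fun w => (f j (X 0%N w) ^+ 2 / y j)%:E) =
    (fun w => ((y j)^-1)%:E * (f j (X 0%N w) ^+ 2)%:E)%E.
  by apply/funext => w; rewrite -EFinM mulrC.
rewrite !ge0_integralZl_EFin ?sqr_ge0//; last 3 first.
- by move=> w _; rewrite lee_fin sqr_ge0.
- by move=> w _; rewrite lee_fin sqr_ge0.
- apply/measurable_EFinP; apply: measurable_funX; apply: measurable_funB => //.
  by apply: measurable_sum => k; exact: mXk.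
apply: (@le_trans _ _ (((y j)^-1 ^+ 2)%:E *
    ((N j)%:R%:E * \int[P]_w (f j (X 0%N w) ^+ 2)%:E))%E).
  apply: lee_wpmul2l; first by rewrite lee_fin sqr_ge0.
  exact: (centered_sum_sqr_le P X iidX (f j) (y j)).
rewrite muleA -EFinM; apply: lee_wpmul2r.
  by apply: integral_ge0 => w _; rewrite lee_fin sqr_ge0.
by rewrite lee_fin expr2 -mulrA ler_piMr// mulrC ler_pdivrMr// mul1r.
Qed.

(** The mean of [B j] is [N j] times the probability that [h (X 0)] exceeds [y j]. Writing the bound
    as an integral lets it merge with [ID] into [phi]. *)
Let IB j : (\int[P]_w (B j w)%:E <=
  \int[P]_w (if h (X 0%N w) <= y j then 0 else y j)%:E)%E.
Proof.
pose b x : R := if h x <= y j then 0 else 1.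
have mb : measurable_fun [set: T'] b by exact: mle.
have b0 x : (0 <= (b x)%:E)%E by rewrite lee_fin /b; case: ifP.
have -> : (fun w => (B j w)%:E) =
    (fun w => \sum_(0 <= k < N j) (b (X k w))%:E)%E.
  by apply/funext => w; rewrite sumEFin.
rewrite ge0_integral_sum//; last first.
  by move=> k; apply/measurable_EFinP; exact: (mXk k b).
rewrite (eq_bigr (fun=> \int[P]_w (b (X 0%N w))%:E)%E); last first.
  move=> k _; apply: (ge0_integral_iid P X iidX k (fun x => (b x)%:E)) => //.
  exact/measurable_EFinP.
have sumc (c : \bar R) n : (0 <= c -> \sum_(0 <= k < n) c = n%:R%:E * c)%E.
  move=> c0; elim: n => [|n IH]; first by rewrite big_geq// mul0e.
  rewrite big_nat_recr//= IH -[n.+1%:R]natr1 EFinD.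
  by rewrite ge0_muleDl ?lee_fin// mul1e.
rewrite sumc; last by apply: integral_ge0 => w _.
have -> : (fun w => (if h (X 0%N w) <= y j then 0 else y j)%:E) =
    (fun w => (y j)%:E * (b (X 0%N w))%:E)%E.
  by apply/funext => w; rewrite -EFinM /b; case: ifP; rewrite ?mulr0 ?mulr1.
rewrite ge0_integralZl_EFin//; [|exact/measurable_EFinP/(mXk 0%N b)|exact: ltW].
apply: lee_wpmul2r; last by rewrite lee_fin.
by apply: integral_ge0 => w _.
Qed.

Let IDB j : (\int[P]_w (D j w + B j w)%:E <= \int[P]_w (phi j (X 0%N w))%:E)%E.
Proof.
have D0 w : 0 <= D j w by exact: sqr_ge0.
have B0 w : 0 <= B j w by apply: sumr_ge0 => k _; case: ifP.
have -> : (fun w => (phi j (X 0%N w))%:E) =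
    (fun w => (f j (X 0%N w) ^+ 2 / y j)%:E +
    (if h (X 0%N w) <= y j then 0 else y j)%:E)%E.
  apply/funext => w; rewrite -EFinD /phi /f.
  case: ifP => _; first by rewrite addr0.
  by rewrite expr0n mul0r add0r.
under eq_integral do rewrite EFinD.
rewrite !ge0_integralD//; last 8 first.
- by move=> w _; rewrite lee_fin divr_ge0 ?sqr_ge0 ?ltW.
- apply/measurable_EFinP; apply: measurable_funM => //.
  by apply: measurable_funX; exact: (mXk 0%N (f j)).
- by move=> w _; rewrite lee_fin; case: ifP => // _; exact: ltW.
- apply/measurable_EFinP.
  by apply: (mXk 0%N (fun x => if h x <= y j then 0 else y j)); exact: mle.
- by move=> w _; rewrite lee_fin.
- exact/measurable_EFinP.
- by move=> w _; rewrite lee_fin.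
- exact/measurable_EFinP.
by apply: leeD; [exact: ID|exact: IB].
Qed.

Let DB0 j w : 0 <= D j w + B j w.
Proof. by rewrite addr_ge0 ?sqr_ge0//; apply: sumr_ge0 => k _; case: ifP. Qed.

Let phi0 j x : 0 <= phi j x.
Proof. by rewrite /phi; case: ifP => _; rewrite ?divr_ge0 ?sqr_ge0 ?ltW. Qed.

Let C := 2 * (1 + a) / (a - 1).

Let sum_phi x : (\sum_(j <oo) (phi j x)%:E <= (C * h x)%:E)%E.
Proof.
apply: lime_le; first by apply: is_cvg_nneseries => j _ _; rewrite lee_fin.
apply: nearW => n; rewrite sumEFin lee_fin.
exact: geometric_truncated_sum_le.
Qed.

(** Tonelli's theorem bounds the mean of the series by that of the series of [phi j (X 0)], hence by
    [C] times the mean of [h (X 0)]. A nonnegative function of finite mean is finite almost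
    everywhere. *)
Let ae_DB : {ae P, forall w, (\sum_(j <oo) (D j w + B j w)%:E < +oo)%E}.
Proof.
pose G w := (\sum_(j <oo) (D j w + B j w)%:E)%E.
have G0 w : (0 <= G w)%E by apply: nneseries_ge0 => j _ _; rewrite lee_fin.
have mDB j : measurable_fun [set: T] (fun w => (D j w + B j w)%:E).
  by apply/measurable_EFinP; exact: measurable_funD.
have mG : measurable_fun [set: T] G.
  by apply: ge0_emeasurable_sum => // j w _ _; rewrite lee_fin.
have iG : P.-integrable [set: T] G.
  apply/integrableP; split => //.
  under eq_integral do rewrite gee0_abs//.
  rewrite integral_nneseries//; last by move=> j w _; rewrite lee_fin.
  apply: (@le_lt_trans _ _ (\sum_(j <oo) \int[P]_w (phi j (X 0%N w))%:E)%E).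
    apply: lee_nneseries => [j _ _|j _]; last exact: IDB.
    by apply: integral_ge0 => w _; rewrite lee_fin.
  have mphiX j : measurable_fun [set: T] (fun w => (phi j (X 0%N w))%:E).
    by apply/measurable_EFinP; exact: (mXk 0%N (phi j)).
  rewrite -integral_nneseries//; last by move=> j w _; rewrite lee_fin.
  apply: (@le_lt_trans _ _ (\int[P]_w (C%:E * (h (X 0%N w))%:E))%E).
    apply: ge0_le_integral.
    - exact: measurableT.
    - by move=> w _; apply: nneseries_ge0 => j _ _; rewrite lee_fin.
    - by apply: ge0_emeasurable_sum => // j w _ _; rewrite lee_fin.
    - apply/measurable_EFinP; apply: measurable_funM => //.
      exact: (mXk 0%N h).
    - by move=> w _; rewrite -EFinM; exact: sum_phi.
  have C0 : 0 <= C.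
    rewrite /C divr_ge0// ?subr_ge0 ?(ltW a1)// mulr_ge0// addr_ge0//.
    by rewrite (le_trans ler01)// ltW.
  rewrite ge0_integralZl_EFin//.
  - by rewrite lte_mul_pinfty// ge0_fin_numE ?lee_fin// ltry.
  - by move=> w _; rewrite lee_fin.
  - by apply/measurable_EFinP; exact: (mXk 0%N h).
have := integrable_ae measurableT iG.
by apply: filterS => w /(_ Logic.I); rewrite ge0_fin_numE.
Qed.

Let ih : P.-integrable [set: T] (EFin \o (fun w => h (X 0%N w))).
Proof.
apply/integrableP; split; first exact/measurable_EFinP/(mXk 0%N h).
by under eq_integral do rewrite /= ger0_norm//.
Qed.

Let yV_cvg : (y j)^-1 @[j --> \oo] --> (0 : R).
Proof.
under eq_fun do rewrite -exprVn.
have a0 : 0 < a by apply: lt_trans a1.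
by apply: cvg_expr; rewrite ger0_norm ?invr_ge0 ?invf_lt1// ltW.
Qed.

Let near_y (c : R) : \forall j \near \oo, c <= y j.
Proof.
have [c0|c0] := leP c 0.
  by apply: nearW => j; exact: le_trans c0 (ltW (y0 j)).
move/cvgrPdist_lt : yV_cvg => /(_ c^-1); rewrite invr_gt0 => /(_ c0).
apply: filterS => j.
rewrite sub0r normrN ger0_norm ?invr_ge0; last exact/ltW/y0.
by move=> cj; rewrite -lef_pV2 ?posrE ?ltW//; exact: y0.
Qed.

Let mu_cvg : mu @ \oo --> m.
Proof.
apply: (@fine_cvg _ _ _ _ (fun j => \int[P]_w (f j (X 0%N w))%:E)%E).
rewrite fineK; last exact: (integrable_fin_num measurableT ih).
have [] // := @dominated_convergence _ _ _ P [set: T] measurableT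
  (fun j w => (f j (X 0%N w))%:E) (fun w => (h (X 0%N w))%:E)
  (fun w => (h (X 0%N w))%:E).
- by move=> j; apply/measurable_EFinP; exact: (mXk 0%N (f j)).
- by apply/measurable_EFinP; exact: (mXk 0%N h).
- apply: aeW => w _; apply: cvg_EFin; first exact: nearW.
  apply: cvg_near_cst; apply: filterS (near_y (h (X 0%N w))) => j hj.
  by rewrite /= /f hj.
- apply: aeW => w j _; rewrite /= lee_fin ger0_norm// /f.
  by case: ifP.
Qed.

Let N_cvg : (N j)%:R / y j @[j --> \oo] --> (1 : R).
Proof.
have y1 : 1 - (y j)^-1 @[j --> \oo] --> (1 : R).
  suff : 1 - (y j)^-1 @[j --> \oo] --> (1 - 0 : R) by rewrite subr0.
  by apply: cvgB yV_cvg; exact: cvg_cst.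
apply: (@squeeze_cvgr _ _ _ _ (fun j => 1 - (y j)^-1) (cst 1)) => //;
  last exact: cvg_cst.
apply: nearW => j /=.
rewrite ler_pdivrMr// mul1r Ny andbT ler_pdivlMr// mulrBl mul1r mulVf ?gt_eqF//.
by rewrite lerBlDr natr1 ltW// truncnS_gt.
Qed.

Lemma strong_law_geometric : {ae P, forall w,
  (\sum_(0 <= k < Num.truncn (a ^+ j)) h (X k w)) / a ^+ j @[j --> \oo] --> m}.
Proof.
apply: filterS ae_DB => w DBoo.
have DB_cvg := nneseries_lty_cvg0 _ _ (fun j => DB0 j w) DBoo.
have B0 j : 0 <= B j w by apply: sumr_ge0 => k _; case: ifP.
have D_cvg : D j w @[j --> \oo] --> (0 : R).
  apply: (@squeeze_cvgr _ _ _ _ (cst 0) (fun j => D j w + B j w)) => //;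
    last exact: cvg_cst.
  apply: nearW => j /=; by rewrite sqr_ge0 lerDl B0.
have T_cvg : (\sum_(0 <= k < N j) f j (X k w) - (N j)%:R * mu j) / y j
    @[j --> \oo] --> (0 : R).
  apply/norm_cvg0P.
  rewrite (_ : (fun j => `|_|) = (fun j => Num.sqrt (D j w))); last first.
    by apply/funext => j; rewrite sqrtr_sqr.
  suff : Num.sqrt (D j w) @[j --> \oo] --> Num.sqrt (0 : R) by rewrite sqrtr0.
  by apply: continuous_cvg => //; exact: sqrt_continuous.
have -> : m = 0 + 1 * m by rewrite add0r mul1r.
(* The centered truncated sum is negligible, so only its mean is left: [N j / y j] tends to 1 and,
   by dominated convergence, [mu j] tends to [m]. *)
have key : (\sum_(0 <= k < N j) f j (X k w) - (N j)%:R * mu j) / y j +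
    (N j)%:R / y j * mu j @[j --> \oo] --> (0 + 1 * m : R).
  by apply: cvgD => //; exact: cvgM.
apply: cvg_trans key; apply: near_eq_cvg.
(* [B j] counts truncated terms, so once it is below 1 there are none and the truncated sum is the
   original one. *)
have /cvgrPdist_lt/(_ 1 ltr01) := DB_cvg.
apply: filterS => j; rewrite sub0r normrN ger0_norm// => DB1.
rewrite /= -/(y j) -/(N j).
have B1 : B j w < 1 by apply: le_lt_trans DB1; rewrite lerDr sqr_ge0.
have -> : \sum_(0 <= k < N j) f j (X k w) = \sum_(0 <= k < N j) h (X k w).
  apply: eq_big_nat => k kN; rewrite /f; case: ifPn => // hy.
  suff : 1 <= B j w by rewrite leNgt B1.
  rewrite /B (bigD1_seq k) ?mem_index_iota ?iota_uniq//= (negbTE hy) lerDl.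
  by apply: sumr_ge0 => l _; case: ifP.
by field; rewrite gt_eqF.
Qed.

End Geometric.

(** The ratios [1 + 1 / (q + 1)] are countably many, so almost surely the convergence holds along
    all of them at once. *)
Theorem strong_law : {ae P, forall w,
  n%:R^-1 * (\sum_(0 <= k < n) h (X k w)) @[n --> \oo] --> m}.
Proof.
have a1 q : 1 < 1 + q.+1%:R^-1 :> R by rewrite ltrDl invr_gt0.
apply: filterS (ae_foralln (fun q => strong_law_geometric _ (a1 q))) => w H.
apply: (cvg_mean_of_geometric_subseq _ (fun n => \sum_(0 <= k < n) h (X k w))).
- by rewrite big_geq.
- move=> i j ij; rewrite [leRHS](big_cat_nat (leq0n i) ij)/= lerDl.
  by apply: sumr_ge0 => k _.
- exact: H.
Qed.

End StrongLaw.

(** * Bernstein-Markov factors of random polynomials *)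

Lemma measurable_modulus (R : realType) :
  measurable_fun [set: borelC R] (modulus : borelC R -> R).
Proof.
apply: (@measurability _ _ (borelC R) R setT _ _ (RGenOInfty.measurableE R)).
move=> _ [_ [r ->] <-].
rewrite setTI; apply: sub_sigma_algebra.
rewrite openE => z /=; rewrite in_itv/= andbT => rz.
apply/nbhs_ballP.
(* By the triangle inequality [modulus] stays above [r] on this ball. The radius is a real number
   seen in [R[i]], where the norm takes its values. *)
exists ((modulus z - r)%:C)%C; first by rewrite /= ltcR subr_gt0.
move=> w; rewrite -ball_normE/= in_itv/= andbT.
change (((modulus (z - w))%:C < (modulus z - r)%:C)%C -> r < modulus w).
rewrite ltcR ltrBrDr -ltrBrDl => /lt_le_trans; apply.
have := le_normcD (z - w) w; rewrite subrK -/(modulus _) => zw.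
by rewrite lerBlDl.
Qed.

Lemma bernstein_markov_random_poly d (Omega : measurableType d) (R : realType)
    (P : probability Omega R) (A : nat -> {RV P >-> borelC R}) n w :
  bernstein_markov (random_poly A n w) =
  Num.sqrt (\sum_(0 <= k < n.+1) k%:R ^+ 2 * modulus (A k w) ^+ 2) /
  Num.sqrt (\sum_(0 <= k < n.+1) modulus (A k w) ^+ 2).
Proof.
rewrite -(bernstein_markov_poly _ (fun k => A k w : R[i])) poly_def.
by rewrite /random_poly big_mkord.
Qed.

Lemma bernstein_markov_random_poly_le d (Omega : measurableType d)
    (R : realType) (P : probability Omega R)
    (A : nat -> {RV P >-> borelC R}) n w :
  0 <= n%:R^-1 * bernstein_markov (random_poly A n w) <= 1.
Proof.
rewrite bernstein_markov_random_poly.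
rewrite mulr_ge0 ?divr_ge0 ?sqrtr_ge0 ?invr_ge0//=.
case: n => [|n]; first by rewrite invr0 mul0r.
rewrite ler_pdivrMl ?ltr0n// mulr1.
set S := \sum_(0 <= k < _) modulus _ ^+ 2; set W := \sum_(0 <= k < _) _.
have S0 : 0 <= S by apply: sumr_ge0 => k _; exact: sqr_ge0.
have WS : Num.sqrt W <= n.+1%:R * Num.sqrt S.
  have -> : n.+1%:R * Num.sqrt S = Num.sqrt (n.+1%:R ^+ 2 * S).
    by rewrite sqrtrM ?sqr_ge0// sqrtr_sqr ger0_norm.
  rewrite ler_sqrt ?mulr_ge0 ?sqr_ge0// mulr_sumr.
  apply: ler_sum_nat => k /andP[_ kn]; apply: ler_wpM2r; first exact: sqr_ge0.
  by rewrite ler_sqr ?nnegrE// ler_nat -ltnS.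
(* If all coefficients vanish, the quotient is 0 by the convention on inverses. *)
have [->|S1] := eqVneq (Num.sqrt S) 0; first by rewrite invr0 mulr0.
by rewrite ler_pdivrMr// lt_neqAle eq_sym S1 sqrtr_ge0.
Qed.

Theorem theorem2 (d : measure_display) (Omega : measurableType d)
    (R : realType) (P : probability Omega R)
    (A : nat -> {RV P >-> borelC R}) :
  iid A ->
  (P [set w | (A 0%N w = 0 :> R[i])%R] < 1)%E ->
  ('E_P[(fun w => modulus (A 0%N w) ^+ 2)%R] < +oo)%E ->
  {ae P, forall w,
     n%:R^-1 * bernstein_markov (random_poly A n w) @[n --> \oo]
       --> (Num.sqrt 3)^-1} /\
  ((n%:R^-1)%:E * 'E_P[fun w => bernstein_markov (random_poly A n w)])%E
    @[n --> \oo] --> ((Num.sqrt 3)^-1)%:E.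
Proof.
move=> iidA A0 EA.
pose h (z : borelC R) : R := modulus z ^+ 2.
have mh : measurable_fun [set: borelC R] h.
  by apply: measurable_funX; exact: measurable_modulus.
have h0 z : 0 <= h z by exact: sqr_ge0.
have hoo : (\int[P]_w (h (A 0%N w))%:E < +oo)%E by move: EA; rewrite unlock.
have mhA k : measurable_fun [set: Omega] (fun w => h (A k w)).
  exact: measurableT_comp.
set m := \int[P]_w h (A 0%N w).
(* If the mean of [modulus (A 0) ^ 2] were 0, then [A 0] would vanish almost surely, against the
   hypothesis on its probability of being 0. *)
have m0 : 0 < m.
  rewrite lt_neqAle Rintegral_ge0// andbT; apply/negP => /eqP m0.
  have I0 : (\int[P]_w `|(h (A 0%N w))%:E| = 0)%E.
    under eq_integral do rewrite gee0_abs ?lee_fin//.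
    rewrite -[LHS]fineK; last first.
      by rewrite ge0_fin_numE//; apply: integral_ge0 => w _; rewrite lee_fin.
    by rewrite [fine _](esym m0).
  have mA0 : measurable [set w | (A 0%N w = 0 :> R[i])%R].
    rewrite (_ : [set w | _] = (fun w => h (A 0%N w)) @^-1` [set 0]).
      by rewrite -[X in measurable X]setTI; exact: mhA.
    apply/seteqP; split => w /=; rewrite /h.
      by move=> ->; rewrite /modulus ComplexField.Normc.normc0 expr0n.
    by move/eqP; rewrite expf_eq0/= => /eqP /ComplexField.Normc.eq0_normc.
  have /(ae_eq_integral_abs _ measurableT) : measurable_fun [set: Omega]
    (fun w => (h (A 0%N w))%:E) by exact/measurable_EFinP.
  move=> /(_ P) [] /(_ I0) hA0 _.
  have : P (~` [set w | (A 0%N w = 0 :> R[i])%R]) = 0%E.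
    apply: measure_negligible; first exact: measurableC.
    apply: filterS hA0 => w /(_ Logic.I) /= [] /eqP.
    by rewrite expf_eq0/= => /eqP /ComplexField.Normc.eq0_normc.
  rewrite probability_setC// => PA0.
  by move: A0; rewrite -sube_gt0 PA0 ltxx.
have as_cvg : {ae P, forall w,
    n%:R^-1 * bernstein_markov (random_poly A n w) @[n --> \oo]
      --> (Num.sqrt 3)^-1}.
  apply: filterS (strong_law P A iidA h mh h0 hoo) => w law.
  under eq_fun do rewrite bernstein_markov_random_poly.
  apply: (cvg_sqrt_ratio _ (fun k => h (A k w)) m m0).
  (* The polynomial of index [n] has [n + 1] coefficients, whence the shift. *)
  by move: law; rewrite -cvg_shiftS.
split=> //.
pose BM n w := bernstein_markov (random_poly A n w).
have mBM n : measurable_fun [set: Omega] (BM n).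
  rewrite (_ : BM n = fun w =>
      Num.sqrt (\sum_(0 <= k < n.+1) k%:R ^+ 2 * h (A k w)) /
      Num.sqrt (\sum_(0 <= k < n.+1) h (A k w))); last first.
    by apply/funext => w; exact: bernstein_markov_random_poly.
  have msqrt (g : Omega -> R) : measurable_fun [set: Omega] g ->
      measurable_fun [set: Omega] (fun w => Num.sqrt (g w)).
    move=> mg; apply: measurableT_comp mg.
    by apply: continuous_measurable_fun; exact: sqrt_continuous.
  apply: measurable_funM.
    apply: msqrt; apply: measurable_sum => k.
    exact: measurable_funM.
  (* The inverse is discontinuous at 0, so its measurability is taken from that of the power [-1],
     with which it agrees on nonnegative reals, 0 included. *)
  have -> : (fun w => (Num.sqrt (\sum_(0 <= k < n.+1) h (A k w)))^-1) =
      (fun w => Num.sqrt (\sum_(0 <= k < n.+1) h (A k w)) `^ (-1)).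
    by apply/funext => w; rewrite powR_inv1.
  have mS : measurable_fun [set: Omega]
      (fun w => Num.sqrt (\sum_(0 <= k < n.+1) h (A k w))).
    by apply: msqrt; exact: measurable_sum.
  exact: (measurableT_comp (measurable_powR (-1)) mS).
have BM_ge0 n w : 0 <= BM n w.
  by rewrite /BM bernstein_markov_random_poly divr_ge0.
have E n : ((n%:R^-1)%:E * 'E_P[BM n] = \int[P]_w (n%:R^-1 * BM n w)%:E)%E.
  rewrite unlock; under [RHS]eq_integral do rewrite EFinM.
  rewrite ge0_integralZl_EFin//; last exact/measurable_EFinP.
  by move=> w _; rewrite lee_fin.
under eq_fun do rewrite E.
have Icst : (\int[P]_w ((Num.sqrt 3)^-1)%:E = ((Num.sqrt 3)^-1)%:E)%E.
  rewrite integral_cst// -[RHS]mule1; congr (_ * _)%E; exact: probability_setT.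
have [_ _] : [/\ P.-integrable [set: Omega] (fun=> ((Num.sqrt 3)^-1)%:E),
    [sequence \int[P]_w `|(n%:R^-1 * BM n w)%:E - ((Num.sqrt 3)^-1)%:E|]_n
      @ \oo --> 0 &
    [sequence \int[P]_w (n%:R^-1 * BM n w)%:E]_n @ \oo -->
      \int[P]_w ((Num.sqrt 3)^-1)%:E]%E.
  apply: (@dominated_convergence _ _ _ _ _ _ _ _ (fun=> 1%E)) => //.
  - by move=> n; apply/measurable_EFinP; exact: measurable_funM.
  - apply: filterS as_cvg => w cw _; apply: cvg_EFin; first exact: nearW.
    exact: cw.
  - exact: finite_measure_integrable_cst.
  - apply: aeW => w n _; rewrite lee_fin.
    have /andP[b0 b1] := bernstein_markov_random_poly_le _ _ _ _ A n w.
    by rewrite ger0_norm.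
by rewrite Icst.
Qed.
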